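(* Fix a positive integer $m$. For each $n\ge1$ and real coefficients $a^{\pm}_{i,j},b^{\pm}_{i,j}$ ($i+j\le n$) let $p^{\pm}=\sum_{i+j=0}^n a^{\pm}_{i,j}x^iy^j$, $q^{\pm}=\sum_{i+j=0}^n b^{\pm}_{i,j}x^iy^j$ and consider $$(\dot x,\dot y)=\begin{cases}(y+\epsilon p^+(x,y),\,-x+\epsilon q^+(x,y)), & y\ge x^{m},\\ (y+\epsilon p^-(x,y),\,-x+\epsilon q^-(x,y)), & y<x^{m}.\end{cases}$$ Let $H(n)$ be the supremum, over all coefficient choices for which the first order Melnikov function $M$ (defined in the context) is not identically zero on $(0,+\infty)$, of the number of zeros of $M$ in $(0,+\infty)$ counted with multiplicity. Then there exist nonnegative integers $k,l$ (independent of $n$) such that $H(n)\le kn+l$ for all $n\ge1$.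
   Context: For $h>0$, the circle $x^2+y^2=h$ meets the curve $y=x^{m}$ at exactly two points $A_h=(-s,(-s)^m)$ and $B_h=(s,s^m)$, where $s>0$ solves $s^2+s^{2m}=h$. $L_h^+$ is the arc of this circle in $\{y\ge x^{m}\}$, oriented clockwise from $A_h$ to $B_h$; $L_h^-$ is the arc in $\{y\le x^{m}\}$, oriented clockwise from $B_h$ to $A_h$. The first order Melnikov function is $M(h)=\int_{L_h^+}(q^+dx-p^+dy)+\int_{L_h^-}(q^-dx-p^-dy)$, $h\in(0,+\infty)$. *)

(* Defs.v *)
From Stdlib Require Import Reals Lra List ClassicalEpsilon.
Open Scope R_scope.

(* Riemann integral of f from a to b (the value when f is Riemann integrable,
   which is the case for the continuous integrands used below). *)
Definition Rint (f : R -> R) (a b : R) : R :=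
  epsilon (inhabits 0)
    (fun I => exists pr : Riemann_integrable f a b, RiemannInt pr = I).

Definition poly2 (n : nat) (c : nat -> nat -> R) (x y : R) : R :=
  sum_f_R0 (fun i => sum_f_R0 (fun j => c i j * x ^ i * y ^ j) (n - i)) n.

Definition s_of (m : nat) (h : R) : R :=
  epsilon (inhabits 0) (fun s => 0 < s /\ s ^ 2 + s ^ (2 * m) = h).

Definition angle_on (r x y : R) : R :=
  epsilon (inhabits 0)
    (fun t => -PI < t <= PI /\ x = r * sin t /\ y = r * cos t).

(* Line integral of q dx - p dy along the circle of radius r,
   (x,y) = (r sin t, r cos t), t from t1 to t2 (clockwise for t1 <= t2). *)
Definition arc_int (r : R) (p q : R -> R -> R) (t1 t2 : R) : R :=
  Rint (fun t => q (r * sin t) (r * cos t) * (r * cos t)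
               - p (r * sin t) (r * cos t) * (- (r * sin t))) t1 t2.

(* First order Melnikov function M(h).  A_h has angle tA in (-PI,0),
   B_h has angle tB in (0,PI); L_h^+ is t in [tA,tB] (through the top point
   (0,sqrt h), which lies in y >= x^m), L_h^- is t in [tB, tA + 2 PI]. *)
Definition Melnikov (m n : nat) (ap bp am bm : nat -> nat -> R) (h : R) : R :=
  let s := s_of m h in
  let r := sqrt h in
  let tA := angle_on r (- s) ((- s) ^ m) in
  let tB := angle_on r s (s ^ m) in
  arc_int r (poly2 n ap) (poly2 n bp) tA tB
  + arc_int r (poly2 n am) (poly2 n bm) tB (tA + 2 * PI).

Definition zero_mult_ge (M : R -> R) (x : R) (k : nat) : Prop :=
  exists D : nat -> R -> R,
    (forall t, 0 < t -> D 0%nat t = M t) /\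
    (forall j t, (S j < k)%nat -> 0 < t -> derivable_pt_lim (D j) t (D (S j) t)) /\
    (forall j, (j < k)%nat -> D j x = 0).

(* Main.v *)
(** Parametrising [h = s^2 + s^(2m)] by the abscissa [s] of [B_h], reduction of
    the integrals of [x^i y^j] along the circle gives
    [M(h) = A(s) theta(s) + B(s)] with [A, B] polynomials of degree at most
    [m(n+1)] and [theta(s) = atan (s / s^m)], whose derivative
    [(1-m) s^m / (s^2 + s^(2m))] is rational.  Each differentiation lowers the
    degree of [A]; after [deg A + 1] of them only a rational function remains,
    whose numerator has degree [O(m^2 n)].  Rolle's theorem, with multiplicities,
    loses one zero per differentiation. *)
Require Import Defs.
From Stdlib Require Import Reals List Lra Lia Permutation ClassicalEpsilon.
From Coquelicot Require Import Coquelicot.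
Open Scope R_scope.

(** * Derivatives on the positive half-line *)

Definition dpos (f f' : R -> R) : Prop := forall t, 0 < t -> is_derive f t (f' t).

Lemma dpos_ext (f g f' g' : R -> R) :
  (forall t, 0 < t -> f t = g t) -> (forall t, 0 < t -> f' t = g' t) ->
  dpos f f' -> dpos g g'.
Proof.
  intros Hfg Hd Hf t Ht. rewrite <- (Hd t Ht).
  apply (is_derive_ext_loc f); [|now apply Hf].
  exists (mkposreal t Ht). intros y Hy. apply Hfg.
  apply Rabs_def2 in Hy. unfold minus, plus, opp in Hy. simpl in Hy. lra.
Qed.

Lemma dpos_unique (f f' g' : R -> R) :
  dpos f f' -> dpos f g' -> forall t, 0 < t -> f' t = g' t.
Proof.
  intros H1 H2 t Ht.
  rewrite <- (is_derive_unique _ _ _ (H1 t Ht)). exact (is_derive_unique _ _ _ (H2 t Ht)).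
Qed.

Lemma dpos_const (c : R) : dpos (fun _ => c) (fun _ => 0).
Proof. intros t _. auto_derive; auto. Qed.

Lemma dpos_plus (f g f' g' : R -> R) :
  dpos f f' -> dpos g g' -> dpos (fun t => f t + g t) (fun t => f' t + g' t).
Proof. intros Hf Hg t Ht. apply (is_derive_plus f g); auto. Qed.

Lemma dpos_mult (f g f' g' : R -> R) :
  dpos f f' -> dpos g g' -> dpos (fun t => f t * g t) (fun t => f' t * g t + f t * g' t).
Proof.
  intros Hf Hg t Ht. apply (is_derive_mult f g); auto. intros; apply Rmult_comm.
Qed.

Lemma dpos_comp (f phi f' phi' : R -> R) :
  (forall t, 0 < t -> 0 < phi t) -> dpos f f' -> dpos phi phi' ->
  dpos (fun t => f (phi t)) (fun t => f' (phi t) * phi' t).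
Proof.
  intros Hp Hf Hphi t Ht. rewrite Rmult_comm.
  apply (is_derive_comp f phi); auto.
Qed.

Lemma dpos_pow (n : nat) : dpos (fun t => t ^ n) (fun t => INR n * t ^ pred n).
Proof. intros t _. auto_derive; auto. ring. Qed.

(** Cancelling [w ^ (k - 1)] in the quotient rule raises the exponent of the denominator by only
    one, which keeps the growth of the numerator's degree independent of [k]. *)
Lemma dpos_div_pow (f w f' w' : R -> R) (k : nat) :
  (forall t, 0 < t -> 0 < w t) -> dpos f f' -> dpos w w' ->
  dpos (fun t => f t / w t ^ k)
       (fun t => (f' t * w t - INR k * w' t * f t) / w t ^ S k).
Proof.
  intros Hw Hf Hd t Ht. assert (Hwt := Hw t Ht).
  pose proof (pow_lt _ k Hwt).
  assert (E1 := is_derive_unique _ _ _ (Hf t Ht)).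
  assert (E2 := is_derive_unique _ _ _ (Hd t Ht)).
  auto_derive.
  - repeat split; [eexists; now apply Hf | eexists; now apply Hd | lra].
  - change (Derive (fun x => f x) t) with (Derive f t).
    change (Derive (fun x => w x) t) with (Derive w t).
    rewrite E1, E2. destruct k as [|k]; simpl in *.
    + field. lra.
    + pose proof (pow_lt _ k Hwt). field. split; lra.
Qed.

(** * Polynomial functions and their degrees *)

(* Polynomial functions of degree at most [d], in Horner form. *)
Fixpoint dP (d : nat) (f : R -> R) : Prop :=
  match d with
  | O => exists c, forall t, f t = c
  | S e => exists c g, dP e g /\ forall t, f t = c + t * g t
  end.

Lemma dP_ext (d : nat) (f g : R -> R) : (forall t, f t = g t) -> dP d f -> dP d g.
Proof.
  destruct d as [|d]; simpl; intros E.
  - intros [c H]. exists c. intros t. now rewrite <- E.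
  - intros (c & k & Hk & H). exists c, k. split; auto. intros t. now rewrite <- E.
Qed.

Lemma dP_const (d : nat) (c : R) : dP d (fun _ => c).
Proof.
  revert c; induction d as [|d IH]; intros c; simpl.
  - now exists c.
  - exists c, (fun _ => 0). split; auto. intros; ring.
Qed.

Lemma dP_mulX (d : nat) (f : R -> R) : dP d f -> dP (S d) (fun t => t * f t).
Proof. intros H. exists 0, f. split; auto. intros; ring. Qed.

Lemma dP_S (d : nat) (f : R -> R) : dP d f -> dP (S d) f.
Proof.
  revert f; induction d as [|d IH]; intros f.
  - intros [c H]. apply (dP_ext _ (fun _ => c)); auto. apply dP_const.
  - intros (c & g & Hg & H). exists c, g. auto.
Qed.

Lemma dP_le (d e : nat) (f : R -> R) : (d <= e)%nat -> dP d f -> dP e f.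
Proof. induction 1; auto using dP_S. Qed.

Lemma dP_plus (d : nat) (f g : R -> R) : dP d f -> dP d g -> dP d (fun t => f t + g t).
Proof.
  revert f g; induction d as [|d IH]; intros f g; simpl.
  - intros [c H] [c' H']. exists (c + c'). intros t. now rewrite H, H'.
  - intros (c & k & Hk & H) (c' & k' & Hk' & H').
    exists (c + c'), (fun t => k t + k' t). split; auto.
    intros t. rewrite H, H'. ring.
Qed.

Lemma dP_scal (d : nat) (a : R) (f : R -> R) : dP d f -> dP d (fun t => a * f t).
Proof.
  revert f; induction d as [|d IH]; intros f; simpl.
  - intros [c H]. exists (a * c). intros t. now rewrite H.
  - intros (c & k & Hk & H). exists (a * c), (fun t => a * k t). split; auto.
    intros t. rewrite H. ring.
Qed.

Lemma dP_mult (d e : nat) (f g : R -> R) :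
  dP d f -> dP e g -> dP (d + e) (fun t => f t * g t).
Proof.
  revert f; induction d as [|d IH]; intros f.
  - intros [c H] Hg. apply (dP_ext _ (fun t => c * g t)).
    + intros t. now rewrite H.
    + now apply dP_scal.
  - intros (c & k & Hk & H) Hg.
    apply (dP_ext _ (fun t => c * g t + t * (k t * g t))).
    + intros t. rewrite H. ring.
    + apply dP_plus.
      * apply (dP_le e); [lia|]. now apply dP_scal.
      * apply (dP_mulX (d + e)). now apply IH.
Qed.

Lemma dP_pow_comp (d n : nat) (f : R -> R) : dP d f -> dP (n * d) (fun t => f t ^ n).
Proof.
  intros Hf; induction n as [|n IH]; simpl.
  - now exists 1.
  - now apply dP_mult.
Qed.

Lemma dP_pow (n : nat) : dP n (fun t => t ^ n).
Proof.
  apply (dP_le (n * 1)); [lia|]. apply (dP_pow_comp 1).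
  exists 0, (fun _ => 1). split; [now exists 1 | intros; ring].
Qed.

Lemma dP_derive (d : nat) (f : R -> R) : dP d f -> exists f', dpos f f' /\ dP (pred d) f'.
Proof.
  revert f; induction d as [|d IH]; intros f.
  - intros [c H]. exists (fun _ => 0). split; [|now exists 0].
    apply (dpos_ext (fun _ => c) _ (fun _ => 0)); auto using dpos_const.
  - intros (c & g & Hg & H). destruct (IH g Hg) as (g' & Dg & Pg).
    exists (fun t => g t + t * g' t). split.
    + apply (dpos_ext (fun t => c + t ^ 1 * g t) _
               (fun t => 0 + (INR 1 * t ^ 0 * g t + t ^ 1 * g' t))).
      * intros t _. rewrite H. ring.
      * intros t _. simpl. ring.
      * apply dpos_plus; [apply dpos_const|]. apply dpos_mult; auto. apply (dpos_pow 1).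
    + simpl. apply dP_plus; auto. destruct d as [|d].
      (* Here the target degree is 0, so [t * g' t] may not contribute at all. The constant [g']
         agrees with 0 at the point 1, hence is 0. *)
      * destruct Hg as [a Ha].
        exists 0. intros t. destruct Pg as [b Hb]. rewrite Hb.
        assert (b = 0) as ->; [|ring].
        rewrite <- (Hb 1).
        apply (dpos_unique g g' (fun _ => 0)); auto; [|lra].
        apply (dpos_ext (fun _ => a) _ (fun _ => 0)); auto using dpos_const.
      * now apply dP_mulX.
Qed.

(** * Order of vanishing *)

(* Only [k - 1] derivatives are required to exist, as in [zero_mult_ge]. *)
Fixpoint vanish (k : nat) (f : R -> R) (x : R) : Prop :=
  match k with
  | O => True
  | S k' => f x = 0 /\ (k' = O \/ exists f', dpos f f' /\ vanish k' f' x)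
  end.

Lemma vanish_ext (k : nat) (f g : R -> R) (x : R) :
  0 < x -> (forall t, 0 < t -> f t = g t) -> vanish k f x -> vanish k g x.
Proof.
  intros Hx E. destruct k as [|k]; simpl; auto. intros [H0 H]. split.
  - now rewrite <- E.
  - destruct H as [H|(f' & Df & H)]; auto. right. exists f'. split; auto.
    now apply (dpos_ext f _ f').
Qed.

Lemma vanish_S (k : nat) (f : R -> R) (x : R) : vanish (S k) f x -> vanish k f x.
Proof.
  revert f; induction k as [|k IH]; intros f; [now simpl|].
  intros [H0 [H|(f' & Df & H)]]; [discriminate|]. split; auto. right. eauto.
Qed.

Lemma vanish_plus (k : nat) (f g : R -> R) (x : R) :
  vanish k f x -> vanish k g x -> vanish k (fun t => f t + g t) x.
Proof.
  revert f g; induction k as [|k IH]; intros f g; [now simpl|].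
  intros [F0 F1] [G0 G1]. split; [lra|].
  destruct F1 as [->|(f' & Df & F1)]; auto.
  destruct G1 as [->|(g' & Dg & G1)]; auto.
  right. exists (fun t => f' t + g' t). split; auto using dpos_plus.
Qed.

(** Leibniz rule: [f' * g] is handled by induction on the order, and [f * g'] because [f] also
    vanishes to the lower order and [g'] is again a polynomial. *)
Lemma vanish_mult_poly (k d : nat) (f g : R -> R) (x : R) :
  dP d g -> vanish k f x -> vanish k (fun t => f t * g t) x.
Proof.
  revert d f g; induction k as [|k IH]; intros d f g Hg; [now simpl|].
  intros HF. pose proof (vanish_S _ _ _ HF) as HF'. destruct HF as [F0 F1].
  split; [rewrite F0; ring|].
  destruct F1 as [->|(f' & Df & F1)]; auto. right.
  destruct (dP_derive d g Hg) as (g' & Dg & Pg).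
  exists (fun t => f' t * g t + f t * g' t). split; [now apply dpos_mult|].
  apply vanish_plus; eauto.
Qed.

(** Chain rule: the factor [phi'] is a polynomial, so [vanish_mult_poly] absorbs it at each
    order. *)
Lemma vanish_comp_poly (k d : nat) (f phi : R -> R) (x : R) :
  (forall t, 0 < t -> 0 < phi t) -> dP d phi ->
  vanish k f (phi x) -> vanish k (fun t => f (phi t)) x.
Proof.
  intros Hp Pp. destruct (dP_derive d phi Pp) as (phi' & Dp & Pp').
  revert f; induction k as [|k IH]; intros f; [now simpl|].
  intros [F0 F1]. split; auto.
  destruct F1 as [->|(f' & Df & F1)]; auto. right.
  exists (fun t => f' (phi t) * phi' t). split; [now apply dpos_comp|].
  apply (vanish_mult_poly k (pred d) (fun t => f' (phi t))); auto.
Qed.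

Lemma vanish_of_zero_mult_ge (k : nat) (M : R -> R) (x : R) :
  0 < x -> zero_mult_ge M x k -> vanish k M x.
Proof.
  intros Hx. revert M; induction k as [|k IH]; intros M; [now simpl|].
  intros (D & H0 & HD & Hz). split; [rewrite <- H0 by auto; apply Hz; lia|].
  destruct k as [|k]; auto. right. exists (D 1%nat). split.
  - apply (dpos_ext (D 0%nat) _ (D 1%nat)); auto.
    intros t Ht. apply is_derive_Reals. apply HD; auto. lia.
  - apply IH. exists (fun j => D (S j)). repeat split; auto.
    + intros j t Hj Ht. apply HD; auto. lia.
    + intros j Hj. apply Hz. lia.
Qed.

(** * Counting zeros, and Rolle's theorem with multiplicities *)

(* [f] has at least [N] zeros in ]a, +oo[, counted with multiplicity. *)
Inductive hz (f : R -> R) : R -> nat -> Prop :=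
| hz_nil a : hz f a 0
| hz_cons a z mu N : a < z -> vanish (S mu) f z -> hz f z N -> hz f a (S mu + N).

Lemma hz_weaken (f : R -> R) (a b : R) (N : nat) : a <= b -> hz f b N -> hz f a N.
Proof.
  intros Hab H. destruct H as [c|c z mu M Hz V H]; [constructor|].
  apply hz_cons with z; auto. lra.
Qed.

Lemma hz_imp (f g : R -> R) (a : R) (N : nat) :
  0 <= a -> (forall k z, 0 < z -> vanish k f z -> vanish k g z) -> hz f a N -> hz g a N.
Proof.
  intros Ha Hv H. induction H as [c|c z mu M Hz V H IH]; [constructor|].
  apply hz_cons with z; auto.
  - apply Hv; auto. lra.
  - apply IH. lra.
Qed.

(** The leftmost zero [z] is singled out because only there is an order lost for good. At every
    later zero the lost order is made up by the Rolle point just before it. *)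
Lemma hz_rolle_aux (f f' : R -> R) (z : R) (N : nat) :
  dpos f f' -> hz f z N ->
  forall a mu, 0 <= a < z -> vanish (S mu) f z -> hz f' a (mu + N).
Proof.
  intros Df H. induction H as [z|z z2 mu2 N Hz V2 H IH]; intros a mu Ha V.
  - destruct mu as [|mu]; [constructor|].
    apply hz_cons with z; [lra| |constructor].
    destruct V as [_ [V|(g & Dg & V)]]; [discriminate|].
    apply (vanish_ext _ g); auto; [lra|]. eapply dpos_unique; eauto.
  - assert (exists xi, z < xi < z2 /\ f' xi = 0) as (xi & Hxi & Exi).
    { destruct (MVT_cor2 f f' z z2 Hz) as (xi & E & Hxi).
      - intros c Hc. apply is_derive_Reals, Df. lra.
      - exists xi. split; auto.
        destruct V as [V _]. destruct V2 as [V2 _]. rewrite V, V2 in E.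
        apply (Rmult_eq_reg_r (z2 - z)); lra. }
    assert (hz f' z (S 0 + (mu2 + N))) as HH.
    { apply hz_cons with xi; [lra|split; auto|]. apply IH; auto. lra. }
    (* The unit moved out of [S mu2] is the simple zero [xi] of [f']. *)
    replace (mu + (S mu2 + N))%nat with (mu + (1 + (mu2 + N)))%nat by lia.
    destruct mu as [|mu]; [apply (hz_weaken _ a z); auto; lra|].
    apply hz_cons with z; [lra| |exact HH].
    destruct V as [_ [V|(g & Dg & V)]]; [discriminate|].
    apply (vanish_ext _ g); auto; [lra|]. eapply dpos_unique; eauto.
Qed.

(** * Upper bounds for the number of zeros *)

Definition zeros_le (f : R -> R) (K : nat) : Prop :=
  (exists t, 0 < t /\ f t <> 0) -> forall N, hz f 0 N -> (N <= K)%nat.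

Lemma zeros_le_mono (f : R -> R) (K L : nat) : (K <= L)%nat -> zeros_le f K -> zeros_le f L.
Proof. intros HKL H E N HN. specialize (H E N HN). lia. Qed.

Lemma zeros_le_rolle (f f' : R -> R) (K : nat) :
  dpos f f' -> zeros_le f' K -> zeros_le f (S K).
Proof.
  intros Df HK (t & Ht & Ft) N HN.
  (* The bound on [f'] is void when [f'] vanishes identically. In that case [f] is a nonzero
     constant and has no zero. *)
  destruct (classic (exists t, 0 < t /\ f' t <> 0)) as [E|E].
  - inversion HN as [|a z mu N' Hz V H]; subst; [lia|].
    assert (mu + N' <= K)%nat; [|lia].
    apply HK; auto. apply (hz_rolle_aux f f' z); auto. lra.
  - inversion HN as [|a z mu N' Hz V H]; subst; [lia|]. exfalso. apply Ft.
    destruct V as [V _]. rewrite <- V.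
    destruct (MVT_gen f z t f') as (c & Hc & Ec).
    + intros x Hx. apply Df. pose proof (Rmin_glb_lt _ _ _ Hz Ht). lra.
    + intros x Hx. apply derivable_continuous_pt. exists (f' x).
      apply is_derive_Reals, Df. pose proof (Rmin_glb_lt _ _ _ Hz Ht). lra.
    + destruct (Req_dec (f' c) 0) as [Z|Z]; [rewrite Z in Ec; lra|].
      exfalso; apply E. exists c. split; auto.
      pose proof (Rmin_glb_lt _ _ _ Hz Ht). lra.
Qed.

Lemma zeros_le_poly (d : nat) (f : R -> R) : dP d f -> zeros_le f d.
Proof.
  revert f; induction d as [|d IH]; intros f Hf.
  - destruct Hf as [c Hc]. intros (t & Ht & Ft) N HN.
    inversion HN as [|a z mu N' Hz V H]; subst; [lia|].
    destruct V as [V _]. rewrite Hc in *. contradiction.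
  - destruct (dP_derive _ _ Hf) as (f' & Df & Pf).
    apply (zeros_le_rolle f f'); auto.
Qed.

(** Multiplying by the polynomial [w ^ k], positive on the half-line, turns [f] into [B] without
    lowering any multiplicity. *)
Lemma zeros_le_rational (d e k : nat) (f B w : R -> R) :
  (forall t, 0 < t -> 0 < w t) -> dP e w -> dP d B ->
  (forall t, 0 < t -> f t = B t / w t ^ k) -> zeros_le f d.
Proof.
  intros Hw Pw PB Hf (t & Ht & Ft) N HN.
  assert (forall t, 0 < t -> w t ^ k <> 0) as W.
  { intros u Hu. apply pow_nonzero. specialize (Hw u Hu). lra. }
  apply (zeros_le_poly d B PB).
  - exists t. split; auto. intros E. apply Ft. rewrite Hf, E by auto. unfold Rdiv. ring.
  - apply (hz_imp f B); auto; [lra|]. intros j z Hz V.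
    apply (vanish_ext _ (fun t => f t * w t ^ k)); auto.
    + intros u Hu. rewrite Hf by auto. field. auto.
    + apply (vanish_mult_poly j (k * e)); auto. now apply dP_pow_comp.
Qed.

(** Differentiation keeps the shape of [f]: [A] becomes [A'], [k] becomes [k + 1], and the numerator
    gains [A * u * w ^ k]. The hypothesis on [b] makes this term fit, and it survives the change of
    [a], [k], [b] into [a - 1], [k + 1], [b + 2 * m]. Each of the [a + 1] differentiations thus
    costs [2 * m] in degree and one zero by Rolle. *)
Lemma zeros_le_transcendental (m a : nat) (th u w : R -> R) :
  (forall t, 0 < t -> 0 < w t) -> dP (2 * m) w -> dP m u ->
  dpos th (fun t => u t / w t) ->
  forall (b k : nat) (f A B : R -> R), (a + m + 2 * m * k <= b)%nat ->
  dP a A -> dP b B -> (forall t, 0 < t -> f t = A t * th t + B t / w t ^ k) ->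
  zeros_le f ((a + 1) * (2 * m + 1) + b).
Proof.
  intros Hw Pw Pu Dth.
  destruct (dP_derive _ _ Pw) as (w' & Dw & Pw').
  induction a as [|a IH]; intros b k f A B Hb PA PB Hf;
    destruct (dP_derive _ _ PA) as (A' & DA & PA');
    destruct (dP_derive _ _ PB) as (B' & DB & PB').
  all: assert (dpos f (fun t => A' t * th t +
         (A t * u t * w t ^ k + B' t * w t + (- INR k) * (w' t * B t)) / w t ^ S k)) as Df.
  1, 3: eapply dpos_ext;
    [ intros t Ht; symmetry; exact (Hf t Ht)
    | | apply dpos_plus; [apply dpos_mult; eassumption
                         |apply dpos_div_pow; eassumption] ];
    intros t Ht; simpl; specialize (Hw t Ht);
    pose proof (pow_lt _ k Hw); field; split; lra.
  all: assert (dP (b + 2 * m) (fun t =>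
         A t * u t * w t ^ k + B' t * w t + (- INR k) * (w' t * B t))) as PB1.
  1, 3: apply dP_plus; [apply dP_plus|apply dP_scal];
    [ eapply dP_le; [|apply dP_mult; [apply dP_mult; eassumption
                                     |apply dP_pow_comp; eassumption]]; nia
    | eapply dP_le; [|apply dP_mult; eassumption]; lia
    | eapply dP_le; [|apply dP_mult; eassumption]; lia ].
  (* [A] is constant here, so one last differentiation removes [th] and leaves a rational
     function. *)
  - assert (forall t, 0 < t -> A' t = 0) as ZA.
    { destruct PA as [c Hc]. apply (dpos_unique A A' (fun _ => 0)); auto.
      apply (dpos_ext (fun _ => c) _ (fun _ => 0)); auto using dpos_const. }
    apply (zeros_le_mono _ (S (b + 2 * m))); [lia|].
    eapply zeros_le_rolle; [exact Df|].
    apply (zeros_le_rational (b + 2 * m) (2 * m) (S k) _ _ w Hw Pw PB1).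
    intros t Ht. rewrite ZA by auto. ring.
  - apply (zeros_le_mono _ (S ((a + 1) * (2 * m + 1) + (b + 2 * m)))); [lia|].
    eapply zeros_le_rolle; [exact Df|].
    eapply (IH (b + 2 * m)%nat (S k)); [lia|exact PA'|exact PB1|reflexivity].
Qed.

(** * Integrals of polynomials along circular arcs *)

Lemma Rint_antiderivative (f F : R -> R) (a b : R) :
  (forall t, is_derive F t (f t)) -> (forall t, ex_derive f t) -> Rint f a b = F b - F a.
Proof.
  intros DF Cf.
  assert (is_RInt f a b (F b - F a)) as HI.
  { apply (is_RInt_derive F f); intros t _; auto. exact (ex_derive_continuous f t (Cf t)). }
  assert (exists I, exists pr : Riemann_integrable f a b, RiemannInt pr = I) as HE.
  { exists (RiemannInt (ex_RInt_Reals_0 _ _ _ (ex_intro _ _ HI))).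
    now exists (ex_RInt_Reals_0 _ _ _ (ex_intro _ _ HI)). }
  unfold Rint. destruct (epsilon_spec (inhabits 0) _ HE) as [pr Hpr].
  rewrite <- Hpr, <- RInt_Reals. now apply is_RInt_unique.
Qed.

(* Total degree at most [d], tested by substituting one-variable polynomials. *)
Definition dP2 (d : nat) (g : R -> R -> R) : Prop :=
  forall m x y, dP m x -> dP m y -> dP (d * m) (fun s => g (x s) (y s)).

Lemma dP2_le (d e : nat) (g : R -> R -> R) : (d <= e)%nat -> dP2 d g -> dP2 e g.
Proof. intros H Hg m x y Hx Hy. apply (dP_le (d * m)); [nia|]. now apply Hg. Qed.

Lemma dP2_const (d : nat) (c : R) : dP2 d (fun _ _ => c).
Proof. intros m x y _ _. apply dP_const. Qed.

Lemma dP2_plus (d : nat) (f g : R -> R -> R) :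
  dP2 d f -> dP2 d g -> dP2 d (fun x y => f x y + g x y).
Proof.
  intros Hf Hg m x y Hx Hy. apply (dP_plus _ (fun s => f (x s) (y s))); auto.
Qed.

Lemma dP2_mult (d e : nat) (f g : R -> R -> R) :
  dP2 d f -> dP2 e g -> dP2 (d + e) (fun x y => f x y * g x y).
Proof.
  intros Hf Hg m x y Hx Hy. rewrite PeanoNat.Nat.mul_add_distr_r.
  apply (dP_mult _ _ (fun s => f (x s) (y s))); auto.
Qed.

Lemma dP2_monomial (i j : nat) : dP2 (i + j) (fun x y => x ^ i * y ^ j).
Proof.
  apply (dP2_mult i j (fun x _ => x ^ i) (fun _ y => y ^ j));
    intros m x y Hx Hy; now apply dP_pow_comp.
Qed.

Lemma dP2_sqnorm : dP2 2 (fun x y => x ^ 2 + y ^ 2).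
Proof.
  intros m x y Hx Hy. apply (dP_plus _ (fun s => x s ^ 2)); now apply (dP_pow_comp m 2).
Qed.

(* The [ex_derive] clause is there to make [g] integrable along the circle. *)
Definition has_prim (d : nat) (g : R -> R -> R) : Prop :=
  exists (kappa : R -> R) (Phi : R -> R -> R),
    dP2 d (fun x y => kappa (x ^ 2 + y ^ 2)) /\ dP2 d Phi /\
    forall r t : R,
      is_derive (fun t : R => kappa (r ^ 2) * t + Phi (r * sin t) (r * cos t)) t
                (g (r * sin t) (r * cos t)) /\
      ex_derive (fun t : R => g (r * sin t) (r * cos t)) t.

Lemma has_prim_ext (d : nat) (f g : R -> R -> R) :
  (forall x y, f x y = g x y) -> has_prim d f -> has_prim d g.
Proof.
  intros E (k & Phi & Pk & PPhi & H). exists k, Phi. split; [|split]; auto.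
  intros r t. split.
  - rewrite <- E. apply H.
  - refine (ex_derive_ext _ _ _ _ (proj2 (H r t))). intros u. apply E.
Qed.

Lemma has_prim_le (d e : nat) (g : R -> R -> R) :
  (d <= e)%nat -> has_prim d g -> has_prim e g.
Proof.
  intros L (k & Phi & Pk & PPhi & H). exists k, Phi. eauto using dP2_le.
Qed.

Lemma has_prim_plus (d : nat) (f g : R -> R -> R) :
  has_prim d f -> has_prim d g -> has_prim d (fun x y => f x y + g x y).
Proof.
  intros (k & Phi & Pk & PPhi & H) (k' & Phi' & Pk' & PPhi' & H').
  exists (fun h => k h + k' h), (fun x y => Phi x y + Phi' x y). split; [|split].
  - now apply (dP2_plus _ (fun x y => k (x ^ 2 + y ^ 2))).
  - now apply dP2_plus.
  - intros r t. split.
    + eapply is_derive_ext;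
        [|exact (is_derive_plus _ _ _ _ _ (proj1 (H r t)) (proj1 (H' r t)))].
      intros u. unfold plus. simpl. ring.
    + exact (ex_derive_plus _ _ _ (proj2 (H r t)) (proj2 (H' r t))).
Qed.

Lemma has_prim_scal (d : nat) (c : R) (g : R -> R -> R) :
  has_prim d g -> has_prim d (fun x y => c * g x y).
Proof.
  intros (k & Phi & Pk & PPhi & H).
  exists (fun h => c * k h), (fun x y => c * Phi x y). split; [|split].
  - apply (dP2_mult 0 d (fun _ _ => c)); auto using dP2_const.
  - apply (dP2_mult 0 d (fun _ _ => c)); auto using dP2_const.
  - intros r t. split.
    + eapply is_derive_ext; [|exact (is_derive_scal _ _ c _ (proj1 (H r t)))].
      intros u. simpl. ring.
    + exact (ex_derive_scal _ c _ (proj2 (H r t))).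
Qed.

Lemma sqnorm_circle (r t : R) : (r * sin t) ^ 2 + (r * cos t) ^ 2 = r ^ 2.
Proof. pose proof (sin2_cos2 t) as E. unfold Rsqr in E. nra. Qed.

(** Along a circle [x ^ 2 + y ^ 2] is the constant [r ^ 2] and passes through the derivative in [t].
    Writing it as a polynomial in [x], [y] makes it count as degree two. *)
Lemma has_prim_sqnorm (d : nat) (g : R -> R -> R) :
  has_prim d g -> has_prim (2 + d) (fun x y => (x ^ 2 + y ^ 2) * g x y).
Proof.
  intros (k & Phi & Pk & PPhi & H).
  exists (fun h => h * k h), (fun x y => (x ^ 2 + y ^ 2) * Phi x y). split; [|split].
  - apply (dP2_mult 2 d (fun x y => x ^ 2 + y ^ 2)); auto using dP2_sqnorm.
  - apply (dP2_mult 2 d (fun x y => x ^ 2 + y ^ 2)); auto using dP2_sqnorm.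
  - intros r t. split.
    + rewrite sqnorm_circle.
      eapply is_derive_ext; [|exact (is_derive_scal _ _ (r ^ 2) _ (proj1 (H r t)))].
      intros u. rewrite sqnorm_circle. simpl. ring.
    + eapply ex_derive_ext;
        [|exact (ex_derive_scal _ (r ^ 2) _ (proj2 (H r t)))].
      intros u. now rewrite sqnorm_circle.
Qed.

(** This is the derivative of [x ^ a * y ^ b] in [t], since [x' = y] and [y' = - x] on the circle;
    no term linear in [t] arises. *)
Lemma has_prim_exact (a b : nat) :
  has_prim (a + b) (fun x y =>
    INR a * (x ^ pred a * y ^ S b) + (- INR b) * (x ^ S a * y ^ pred b)).
Proof.
  exists (fun _ => 0), (fun x y => x ^ a * y ^ b).
  split; [apply dP2_const|split; [apply dP2_monomial|]].
  intros r t. split.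
  - auto_derive; auto. rewrite <- !tech_pow_Rmult. ring.
  - auto_derive; auto.
Qed.

(* Integration by parts lowers an exponent by two at the cost of a factor [x^2+y^2]. *)
Lemma has_prim_monomial (i j : nat) : has_prim (i + j) (fun x y => x ^ i * y ^ j).
Proof.
  remember (i + j)%nat as N eqn:EN.
  revert i j EN; induction N as [N IH] using (well_founded_induction Wf_nat.lt_wf).
  intros i j ->.
  destruct j as [|[|j]].
  2: destruct i as [|[|i]].
  1: destruct i as [|[|i]].
  (* The monomial 1, with primitive [t], is the only base case with nonzero [kappa]. *)
  - exists (fun _ => 1), (fun _ _ => 0).
    split; [apply dP2_const|split; [apply dP2_const|]].
    intros r t. split; auto_derive; auto; simpl; ring.
  - apply (has_prim_ext _ (fun x y => (-1) *
      (INR 0 * (x ^ pred 0 * y ^ S 1) + (- INR 1) * (x ^ S 0 * y ^ pred 1)))).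
    + intros x y. simpl. ring.
    + apply has_prim_scal. apply (has_prim_exact 0 1).
  (* Take the exact form of [x ^ (i+1) * y] and replace [y ^ 2] by [(x ^ 2 + y ^ 2) - x ^ 2]: the
     coefficient of [x ^ (i+2)] becomes [-(i + 2)], whence the divisor. *)
  - apply (has_prim_ext _ (fun x y => / INR (S (S i)) * ((-1) *
      (INR (S i) * (x ^ pred (S i) * y ^ S 1) + (- INR 1) * (x ^ S (S i) * y ^ pred 1))
      + INR (S i) * ((x ^ 2 + y ^ 2) * (x ^ i * y ^ 0))))).
    + intros x y. pose proof (pos_INR i). rewrite !S_INR. simpl. field. lra.
    + apply has_prim_scal, has_prim_plus; apply has_prim_scal.
      * apply (has_prim_le (S i + 1)); [lia|]. apply has_prim_exact.
      * apply (has_prim_le (2 + (i + 0))); [lia|]. apply (has_prim_sqnorm (i + 0)), IH; lia.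
  - apply (has_prim_ext _ (fun x y =>
      (INR 1 * (x ^ pred 1 * y ^ S 0) + (- INR 0) * (x ^ S 1 * y ^ pred 0)))).
    + intros x y. simpl. ring.
    + apply (has_prim_exact 1 0).
  - apply (has_prim_ext _ (fun x y => (- / 2) *
      (INR 0 * (x ^ pred 0 * y ^ S 2) + (- INR 2) * (x ^ S 0 * y ^ pred 2)))).
    + intros x y. simpl. field.
    + apply has_prim_scal. apply (has_prim_exact 0 2).
  - apply (has_prim_ext _ (fun x y => / (INR (S (S i)) + 1) * ((-1) *
      (INR (S i) * (x ^ pred (S i) * y ^ S 2) + (- INR 2) * (x ^ S (S i) * y ^ pred 2))
      + INR (S i) * ((x ^ 2 + y ^ 2) * (x ^ i * y ^ 1))))).
    + intros x y. pose proof (pos_INR i). rewrite !S_INR. simpl. field. lra.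
    + apply has_prim_scal, has_prim_plus; apply has_prim_scal.
      * apply (has_prim_le (S i + 2)); [lia|]. apply has_prim_exact.
      * apply (has_prim_le (2 + (i + 1))); [lia|]. apply (has_prim_sqnorm (i + 1)), IH; lia.
  (* Here [x ^ 2] is eliminated instead, from the exact form of [x ^ (i+1) * y ^ (j+1)]; the
     coefficients [i + 1] and [j + 1] add up to the divisor. *)
  - apply (has_prim_ext _ (fun x y => / (INR i + INR (S (S j))) * (
      (INR (S i) * (x ^ pred (S i) * y ^ S (S j))
         + (- INR (S j)) * (x ^ S (S i) * y ^ pred (S j)))
      + INR (S j) * ((x ^ 2 + y ^ 2) * (x ^ i * y ^ j))))).
    + intros x y. pose proof (pos_INR i). pose proof (pos_INR j). rewrite !S_INR. simpl. field. lra.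
    + apply has_prim_scal, has_prim_plus; [|apply has_prim_scal].
      * apply (has_prim_le (S i + S j)); [lia|]. apply has_prim_exact.
      * apply (has_prim_le (2 + (i + j))); [lia|]. apply (has_prim_sqnorm (i + j)), IH; lia.
Qed.

Lemma has_prim_sum (d n : nat) (g : nat -> R -> R -> R) :
  (forall i, (i <= n)%nat -> has_prim d (g i)) ->
  has_prim d (fun x y => sum_f_R0 (fun i => g i x y) n).
Proof.
  induction n as [|n IH]; intros H; simpl.
  - now apply (H 0%nat).
  - apply (has_prim_plus d (fun x y => sum_f_R0 (fun i => g i x y) n)); auto.
Qed.

(** The extra monomial will be [y] or [x], coming from [dx = y dt] and [dy = - x dt]. *)
Lemma has_prim_poly2 (n a b : nat) (c : nat -> nat -> R) :
  has_prim (n + (a + b)) (fun x y => poly2 n c x y * (x ^ a * y ^ b)).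
Proof.
  apply (has_prim_ext _ (fun x y => sum_f_R0 (fun i => sum_f_R0 (fun j =>
           c i j * (x ^ (i + a) * y ^ (j + b))) (n - i)) n)).
  - intros x y. unfold poly2. rewrite Rmult_comm, scal_sum. apply sum_eq. intros i _.
    rewrite Rmult_comm, scal_sum. apply sum_eq. intros j _.
    rewrite !pow_add. ring.
  - apply has_prim_sum. intros i Hi. apply has_prim_sum. intros j Hj.
    apply has_prim_scal. apply (has_prim_le ((i + a) + (j + b))); [lia|].
    apply has_prim_monomial.
Qed.

Lemma arc_int_poly2 (n : nat) (a b : nat -> nat -> R) :
  exists (kappa : R -> R) (Phi : R -> R -> R),
    dP2 (n + 1) (fun x y => kappa (x ^ 2 + y ^ 2)) /\ dP2 (n + 1) Phi /\
    forall r t1 t2, arc_int r (poly2 n a) (poly2 n b) t1 t2 =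
      kappa (r ^ 2) * (t2 - t1)
      + (Phi (r * sin t2) (r * cos t2) - Phi (r * sin t1) (r * cos t1)).
Proof.
  assert (has_prim (n + 1) (fun x y => poly2 n b x y * y - poly2 n a x y * (- x)))
    as (k & Phi & Pk & PPhi & H).
  { apply (has_prim_ext _ (fun x y =>
      poly2 n b x y * (x ^ 0 * y ^ 1) + poly2 n a x y * (x ^ 1 * y ^ 0))).
    - intros x y. simpl. ring.
    - apply has_prim_plus; [apply (has_prim_poly2 n 0 1)|apply (has_prim_poly2 n 1 0)]. }
  exists k, Phi. split; [|split]; auto. intros r t1 t2. unfold arc_int.
  rewrite (Rint_antiderivative _
    (fun t => k (r ^ 2) * t + Phi (r * sin t) (r * cos t))).
  - ring.
  - intros t. apply (H r t).
  - intros t. apply (H r t).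
Qed.

(** * Polar angles and the parametrisation by the abscissa *)

Lemma angle_on_polar (r t : R) :
  0 < r -> - PI < t <= PI -> angle_on r (r * sin t) (r * cos t) = t.
Proof.
  intros Hr Ht. unfold angle_on.
  destruct (epsilon_spec (inhabits 0)
    (fun u => - PI < u <= PI /\ r * sin t = r * sin u /\ r * cos t = r * cos u)
    (ex_intro _ t (conj Ht (conj eq_refl eq_refl)))) as (Hu & Es & Ec).
  set (u := epsilon _ _) in *. clearbody u.
  apply Rmult_eq_reg_l in Es; [|lra]. apply Rmult_eq_reg_l in Ec; [|lra].
  assert (cos (u - t) = 1) as E1.
  { rewrite cos_minus, <- Es, <- Ec. pose proof (sin2_cos2 t) as E.
    unfold Rsqr in E. lra. }
  (* Both angles lie in a half-open interval of length [2 * PI], so the half difference is below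
     [PI] in absolute value, where sine vanishes only at 0. *)
  assert (sin ((u - t) / 2) = 0) as E2.
  { replace (u - t) with (2 * ((u - t) / 2)) in E1 by field.
    rewrite cos_2a_sin in E1. nra. }
  destruct (Rtotal_order u t) as [L|[L|L]]; auto; exfalso.
  - assert (0 < sin ((t - u) / 2)) by (apply sin_gt_0; lra).
    replace ((u - t) / 2) with (- ((t - u) / 2)) in E2 by field.
    rewrite sin_neg in E2. lra.
  - assert (0 < sin ((u - t) / 2)) by (apply sin_gt_0; lra). lra.
Qed.

Definition radius2 (m : nat) (s : R) : R := s ^ 2 + s ^ (2 * m).

Lemma radius2_sqnorm (m : nat) (s : R) : radius2 m s = s ^ 2 + (s ^ m) ^ 2.
Proof. unfold radius2. now rewrite <- pow_mult, PeanoNat.Nat.mul_comm. Qed.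

Lemma radius2_pos (m : nat) (s : R) : 0 < s -> 0 < radius2 m s.
Proof. intros Hs. apply Rplus_lt_0_compat; now apply pow_lt. Qed.

Lemma radius2_le (m : nat) (s t : R) : 0 <= s <= t -> radius2 m s <= radius2 m t.
Proof. intros H. apply Rplus_le_compat; now apply pow_incr. Qed.

Lemma radius2_lt (m : nat) (s t : R) : 0 <= s < t -> radius2 m s < radius2 m t.
Proof.
  intros H. unfold radius2. assert (s ^ (2 * m) <= t ^ (2 * m)) by (apply pow_incr; lra).
  nra.
Qed.

(** Intermediate values on [[0, h + 1]]: [radius2] vanishes at 0 because [m] is positive, and
    [(h + 1) ^ 2] already exceeds [h]. *)
Lemma radius2_surj (m : nat) (h : R) :
  (0 < m)%nat -> 0 < h -> exists s, 0 < s /\ radius2 m s = h.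
Proof.
  intros Hm Hh.
  assert (radius2 m 0 = 0) as R0.
  { unfold radius2. rewrite !pow_ne_zero by lia. ring. }
  destruct (IVT_gen (radius2 m) 0 (h + 1) h) as (s & Hs & E).
  - intros x. apply derivable_continuous_pt. unfold radius2.
    eexists. apply is_derive_Reals. auto_derive; auto.
  - rewrite R0. assert (0 < (h + 1) ^ (2 * m)) by (apply pow_lt; lra).
    assert (h <= radius2 m (h + 1)) by (unfold radius2; nra).
    rewrite Rmin_left, Rmax_right; lra.
  - exists s. split; auto. rewrite Rmin_left in Hs by lra.
    destruct (Rle_lt_or_eq_dec 0 s) as [|E0]; [lra|lra|]. rewrite <- E0, R0 in E. lra.
Qed.

Lemma s_of_radius2 (m : nat) (s : R) : 0 < s -> s_of m (radius2 m s) = s.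
Proof.
  intros Hs. unfold s_of.
  destruct (epsilon_spec (inhabits 0)
    (fun u => 0 < u /\ u ^ 2 + u ^ (2 * m) = radius2 m s)
    (ex_intro _ s (conj Hs eq_refl))) as (Hu & E).
  set (u := epsilon _ _) in *. clearbody u. fold (radius2 m u) in E.
  destruct (Rtotal_order u s) as [L|[L|L]]; auto; exfalso.
  - pose proof (radius2_lt m u s). lra.
  - pose proof (radius2_lt m s u). lra.
Qed.

(** The angle of [B_h], measured clockwise from the positive y-axis as in [angle_on]; its tangent is
    therefore x/y. *)
Definition polar_angle (m : nat) (s : R) : R := atan (s / s ^ m).

Lemma polar_angle_sin_cos (m : nat) (s : R) :
  0 < s -> sqrt (radius2 m s) * sin (polar_angle m s) = s /\
           sqrt (radius2 m s) * cos (polar_angle m s) = s ^ m.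
Proof.
  intros Hs. pose proof (pow_lt s m Hs) as Hp. unfold polar_angle.
  assert (0 < 1 + (s / s ^ m)²) as Hq by (pose proof (Rle_0_sqr (s / s ^ m)); lra).
  assert (sqrt (radius2 m s) = s ^ m * sqrt (1 + (s / s ^ m)²)) as ->.
  { rewrite <- (sqrt_pow2 (s ^ m)) at 1 by lra. rewrite <- sqrt_mult; [|nra|lra].
    f_equal. rewrite radius2_sqnorm. unfold Rsqr. field. lra. }
  rewrite sin_atan, cos_atan. pose proof (sqrt_lt_R0 _ Hq).
  split; field; lra.
Qed.

Lemma polar_angle_bound (m : nat) (s : R) : 0 < s -> 0 < polar_angle m s < PI / 2.
Proof.
  intros Hs. pose proof (pow_lt s m Hs). unfold polar_angle. split.
  - rewrite <- atan_0. apply atan_increasing. now apply Rdiv_lt_0_compat.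
  - apply atan_bound.
Qed.

Lemma polar_angle_derive (m : nat) :
  dpos (polar_angle m) (fun s => ((1 - INR m) * s ^ m) / radius2 m s).
Proof.
  intros s Hs. pose proof (pow_lt s m Hs) as Hp.
  pose proof (radius2_pos m s Hs) as Hr. rewrite radius2_sqnorm in *.
  unfold polar_angle. auto_derive; [lra|].
  (* Removing [pred] leaves [s ^ m] as the only power depending on [m], so it can be generalised to
     an atom for [field]. *)
  assert (INR m * s ^ pred m = INR m * s ^ m / s) as E.
  { destruct m as [|m]; simpl; [|simpl in *]; field; lra. }
  rewrite (Rmult_1_l (INR m * s ^ pred m)), E. clear E.
  generalize dependent (s ^ m). intros p Hp Hr. field. repeat split; nra.
Qed.

(** For even [m], [A_h] is the mirror image of [B_h] in the y-axis, with angle [- theta]; for odd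
    [m] it is the antipode, with angle [theta - PI]. The affine form hides the parity in two
    constants. *)
Lemma angle_A (m : nat) :
  exists eps delta : R, forall s, 0 < s ->
    let r := sqrt (radius2 m s) in
    let tA := eps * polar_angle m s + delta in
    - PI < tA <= PI /\ r * sin tA = - s /\ r * cos tA = (- s) ^ m.
Proof.
  pose proof PI_RGT_0.
  destruct (PeanoNat.Nat.Even_or_Odd m) as [[k Ek]|[k Ek]];
    [exists (-1), 0 | exists 1, (- PI)]; intros s Hs r tA;
    destruct (polar_angle_sin_cos m s Hs) as [Es Ec]; fold r in Es, Ec;
    pose proof (polar_angle_bound m s Hs).
  - assert (tA = - polar_angle m s) as -> by (unfold tA; ring).
    rewrite sin_neg, cos_neg. split; [lra|split; [lra|]].
    rewrite Ec, Ek, !pow_mult. f_equal. ring.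
  - assert (tA = - (PI - polar_angle m s)) as -> by (unfold tA; ring).
    rewrite sin_neg, cos_neg, sin_PI_x, Rtrigo_facts.cos_pi_minus.
    split; [lra|split; [lra|]].
    replace ((- s) ^ m) with (- s ^ m); [lra|].
    rewrite Ek, !pow_add, !pow_mult. replace ((- s) ^ 2) with (s ^ 2) by ring. ring.
Qed.

(** * The Melnikov function as a polynomial combination of 1 and the angle *)

Lemma Melnikov_transcendental (m n : nat) (ap bp am bm : nat -> nat -> R) :
  (0 < m)%nat ->
  exists A B : R -> R, dP ((n + 1) * m) A /\ dP ((n + 1) * m) B /\
    forall s, 0 < s ->
      Melnikov m n ap bp am bm (radius2 m s) = A s * polar_angle m s + B s.
Proof.
  intros Hm.
  destruct (arc_int_poly2 n ap bp) as (k & Phi & Pk & PPhi & H).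
  destruct (arc_int_poly2 n am bm) as (k' & Phi' & Pk' & PPhi' & H').
  destruct (angle_A m) as (eps & delta & HA).
  assert (dP m (fun s => s)) as P1.
  { apply (dP_ext _ (fun s => s ^ 1)); [intros; ring|].
    apply (dP_le 1); auto using dP_pow. }
  assert (dP m (fun s => - s)) as P2.
  { apply (dP_ext _ (fun s => (-1) * s)); [intros; ring|]. now apply dP_scal. }
  assert (dP m (fun s => (- s) ^ m)) as P3.
  { apply (dP_le (m * 1)); [lia|]. apply (dP_pow_comp 1).
    apply (dP_ext _ (fun s => (-1) * s ^ 1)); [intros; ring|].
    apply dP_scal, dP_pow. }
  pose proof (dP_pow m) as P4.
  assert (forall q, dP2 (n + 1) (fun x y => q (x ^ 2 + y ^ 2)) ->
            dP ((n + 1) * m) (fun s => q (radius2 m s))) as Pq.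
  { intros q Hq. apply (dP_ext _ (fun s => q (s ^ 2 + (s ^ m) ^ 2))).
    - intros s. now rewrite radius2_sqnorm.
    - exact (Hq m _ _ P1 P4). }
  (* The two arcs have angular lengths [(1 - eps) * theta - delta] and
     [(eps - 1) * theta + delta + 2 * PI]. Their [theta] parts give [A]; their constants and the
     endpoint values of [Phi], [Phi'] give [B]. *)
  exists (fun s => (1 - eps) * (k (radius2 m s) + (-1) * k' (radius2 m s))),
    (fun s => (- delta) * k (radius2 m s) + (delta + 2 * PI) * k' (radius2 m s)
      + (Phi s (s ^ m) + (-1) * Phi (- s) ((- s) ^ m))
      + (Phi' (- s) ((- s) ^ m) + (-1) * Phi' s (s ^ m))).
  split; [|split].
  - apply dP_scal, (dP_plus _ (fun s => k (radius2 m s))); auto using dP_scal.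
  - repeat apply dP_plus; repeat apply dP_scal; auto;
      solve [apply PPhi; auto | apply PPhi'; auto].
  - intros s Hs. unfold Melnikov. rewrite s_of_radius2 by auto.
    destruct (HA s Hs) as (Ht & Es & Ec).
    destruct (polar_angle_sin_cos m s Hs) as [Es' Ec'].
    pose proof (polar_angle_bound m s Hs) as Hb.
    pose proof (radius2_pos m s Hs) as Hr.
    set (r := sqrt (radius2 m s)) in *.
    set (tA := eps * polar_angle m s + delta) in *.
    assert (0 < r) as Hr' by now apply sqrt_lt_R0.
    assert (angle_on r (- s) ((- s) ^ m) = tA) as ->.
    { rewrite <- Ec, <- Es. now apply angle_on_polar. }
    assert (angle_on r s (s ^ m) = polar_angle m s) as ->.
    { rewrite <- Es', <- Ec' at 1. apply angle_on_polar; auto. lra. }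
    rewrite H, H'.
    replace (sin (tA + 2 * PI)) with (sin tA)
      by (rewrite sin_plus, sin_2PI, cos_2PI; ring).
    replace (cos (tA + 2 * PI)) with (cos tA)
      by (rewrite cos_plus, sin_2PI, cos_2PI; ring).
    rewrite Es, Ec, Es', Ec'.
    assert (r ^ 2 = radius2 m s) as -> by (apply pow2_sqrt; lra).
    unfold tA. ring.
Qed.

(** * Ordering a list of zeros and pulling it back to the abscissa *)

Inductive sorted_zeros : R -> list (R * nat) -> Prop :=
| sz_nil a : sorted_zeros a nil
| sz_cons a z mu l : a < z -> sorted_zeros z l -> sorted_zeros a ((z, mu) :: l).

Fixpoint insert_zero (p : R * nat) (l : list (R * nat)) : list (R * nat) :=
  match l with
  | nil => p :: nil
  | q :: l' => if Rlt_dec (fst p) (fst q) then p :: l else q :: insert_zero p l'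
  end.

Lemma insert_zero_sorted (a z : R) (mu : nat) (l : list (R * nat)) :
  a < z -> ~ In z (map fst l) -> sorted_zeros a l -> sorted_zeros a (insert_zero (z, mu) l).
Proof.
  intros Ha Hz H. induction H as [a|a y nu l Hay H IH]; simpl.
  - repeat constructor; auto.
  - simpl in Hz. destruct (Rlt_dec z y) as [L|L]; repeat constructor; auto.
    apply IH; auto. destruct (Rtotal_order y z) as [|[|]]; auto; [tauto|lra].
Qed.

Lemma insert_zero_permutation (p : R * nat) (l : list (R * nat)) :
  Permutation (p :: l) (insert_zero p l).
Proof.
  induction l as [|q l IH]; simpl; auto.
  destruct (Rlt_dec (fst p) (fst q)); auto.
  apply (perm_trans (perm_swap q p l)). now constructor.
Qed.

Lemma zeros_sortable (zs : list (R * nat)) :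
  NoDup (map fst zs) -> (forall z mu, In (z, mu) zs -> 0 < z) ->
  exists l, Permutation zs l /\ sorted_zeros 0 l.
Proof.
  induction zs as [|[z mu] zs IH]; simpl; intros Hd Hp.
  - exists nil. split; constructor.
  - inversion Hd as [|? ? Hz Hd']; subst.
    destruct IH as (l & Pl & Sl); eauto.
    exists (insert_zero (z, mu) l). split.
    + eapply perm_trans; [|apply insert_zero_permutation]. now constructor.
    + apply insert_zero_sorted; eauto.
      intros Hin. apply Hz. eapply Permutation_in; [|exact Hin].
      apply Permutation_map. now apply Permutation_sym.
Qed.

Lemma list_sum_permutation (l l' : list nat) : Permutation l l' -> list_sum l = list_sum l'.
Proof. induction 1; simpl; lia. Qed.

(** [radius2] is an increasing bijection of the half-line, so preimages keep their order; being a
    polynomial, it preserves the order of vanishing by [vanish_comp_poly]. *)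
Lemma hz_pullback (m : nat) (M : R -> R) (b : R) (l : list (R * nat)) :
  (0 < m)%nat -> sorted_zeros b l -> (forall z mu, In (z, mu) l -> vanish mu M z) ->
  forall a, 0 <= a -> b = radius2 m a ->
  hz (fun s => M (radius2 m s)) a (list_sum (map snd l)).
Proof.
  intros Hm H. induction H as [b|b z mu l Hz H IH]; intros HV a Ha ->; simpl.
  - constructor.
  - assert (0 <= radius2 m a).
    { apply Rplus_le_le_0_compat; now apply pow_le. }
    destruct (radius2_surj m z Hm) as (s & Hs & E); [lra|].
    assert (a < s).
    { destruct (Rlt_or_le a s) as [|L]; auto.
      pose proof (radius2_le m s a). lra. }
    assert (hz (fun s => M (radius2 m s)) s (list_sum (map snd l))) as HH.
    { apply IH; auto; [|lra]. intros; apply HV. now right. }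
    (* A listed zero may carry multiplicity 0; it adds nothing to the sum and is skipped. *)
    destruct mu as [|mu]; [apply (hz_weaken _ a s); auto; lra|].
    apply hz_cons with s; auto.
    apply (vanish_comp_poly _ (2 * m)).
    + apply radius2_pos.
    + apply dP_plus; [apply (dP_le 2); [lia|]|]; apply dP_pow.
    + rewrite E. apply HV. now left.
Qed.

(** * The bound linear in [n] *)

Theorem theorem1p2 :
  forall m : nat, (0 < m)%nat ->
  exists k l : nat,
    forall n : nat, (1 <= n)%nat ->
    forall ap bp am bm : nat -> nat -> R,
      (exists h, 0 < h /\ Melnikov m n ap bp am bm h <> 0) ->
      forall zs : list (R * nat),
        NoDup (map fst zs) ->
        (forall z mu, In (z, mu) zs ->
           0 < z /\ zero_mult_ge (Melnikov m n ap bp am bm) z mu) ->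
        (list_sum (map snd zs) <= k * n + l)%nat.
Proof.
  (* With [D = (n + 1) * m], the bound [(D + 1) * (2 * m + 1) + (D + m)] equals
     [D * (2 * m + 2) + 3 * m + 1]; expanding [D] gives these constants. *)
  intros m Hm. exists (m * (2 * m + 2))%nat, (m * (2 * m + 2) + 3 * m + 1)%nat.
  intros n _ ap bp am bm (h & Hh & Mh) zs Hd Hz.
  destruct (Melnikov_transcendental m n ap bp am bm Hm) as (A & B & PA & PB & E).
  set (M := Melnikov m n ap bp am bm) in *.
  destruct (zeros_sortable zs Hd) as (l & Pl & Sl).
  { intros z mu Hin. now apply (Hz z mu). }
  rewrite (list_sum_permutation _ _ (Permutation_map snd Pl)).
  assert (hz (fun s => M (radius2 m s)) 0 (list_sum (map snd l))) as HH.
  { apply (hz_pullback m M 0); auto; [|lra|].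
    - intros z mu Hin. apply (Permutation_in _ (Permutation_sym Pl)) in Hin.
      destruct (Hz z mu Hin). now apply vanish_of_zero_mult_ge.
    - unfold radius2. rewrite !pow_ne_zero by lia. ring. }
  pose (D := ((n + 1) * m)%nat).
  assert (list_sum (map snd l) <= (D + 1) * (2 * m + 1) + (D + m))%nat;
    [|unfold D in *; nia].
  (* The denominator starts at exponent 0, and [D + m] is the least [b] allowed with [a = D]. *)
  refine (zeros_le_transcendental m D (polar_angle m)
            (fun s => (1 - INR m) * s ^ m) (radius2 m) _ _ _ _
            (D + m) 0 (fun s => M (radius2 m s)) A B _ PA _ _ _ _ HH).
  - apply radius2_pos.
  - apply dP_plus; [apply (dP_le 2); [lia|]|]; apply dP_pow.
  - apply dP_scal, dP_pow.
  - apply polar_angle_derive.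
  - lia.
  - apply (dP_le D); auto. lia.
  - intros s Hs. rewrite E by auto. simpl. field.
  - destruct (radius2_surj m h Hm Hh) as (s & Hs & Es).
    exists s. rewrite Es. auto.
Qed.
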